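(* For all $t\ge2$ and all $1\le n\le m\le\infty$, the square formed by the maps $\pi_t[m]:\vec{\mathscr{X}}_t[m]\to\vec{\mathscr{X}}_{t-1}[m]$, $\pi_t[n]:\vec{\mathscr{X}}_t[n]\to\vec{\mathscr{X}}_{t-1}[n]$, $d_t[m\to n]:\vec{\mathscr{X}}_t[m]\to\vec{\mathscr{X}}_t[n]$ and $d_{t-1}[m\to n]:\vec{\mathscr{X}}_{t-1}[m]\to\vec{\mathscr{X}}_{t-1}[n]$ commutes: $d_{t-1}[m\to n]\circ\pi_t[m]=\pi_t[n]\circ d_t[m\to n]$.
   Context: Diagrams are on a fixed base, the oriented line $\mathbb{R}$ or the oriented circle $S^1$. For $m\in\mathbb{N}\cup\{\infty\}$ ($\infty+1=\infty$), $\vec{\mathscr{A}}[m]$ is the set of signed arrow diagrams: the base with finitely many arrows with distinct endpoints, each arrow carrying a sign $\oplus/\ominus$ and an arbitrary label in $\{1,\dots,m+1\}$ (in $\{1,2,\dots\}\cup\{\infty\}$ if $m=\infty$), up to orientation-preserving homeomorphism. An arrow is isolated if its endpoints are consecutive. Relations in $\mathbb{Z}[\vec{\mathscr{A}}[m]]$: $\vec{\mathrm{Q1}}[m]$: $D=0$ if $D$ has an isolated arrow labelled $m+1$. $\vec{\mathrm{Q2}}[m]$: $D+(D\setminus a)+(D\setminus b)=0$ if $a,b$ are arrows of $D$ with opposite signs, equal labels, adjacent tails and adjacent heads. $\vec{\mathrm{Q3}}[m]$: let $1,2,3$ be disjoint intervals of the base (in any order), and let $D$ have three arrows of equal sign $a:1\to2$,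 $b:1\to3$, $c:2\to3$ whose endpoints occur on interval 1 in the order $a,b$, on interval 2 in the order $a,c$, on interval 3 in the order $b,c$ (no other endpoints on these intervals); let $D'$ be $D$ with the order of the two endpoints reversed on each of the three intervals; the labels $i,j,k$ of $a,b,c$ (the same in $D$ and $D'$) satisfy $i>j=k$, or $j>i=k$, or $k>i=j$, or $i=j=k=m+1$; then $D+(D\setminus a)+(D\setminus b)+(D\setminus c)=D'+(D'\setminus a)+(D'\setminus b)+(D'\setminus c)$. $\vec{A}_t[m]$ is the set of diagrams with more than $t$ arrows, and $\vec{\mathscr{X}}_t[m]=\mathbb{Z}[\vec{\mathscr{A}}[m]]/\langle\vec{\mathrm{Q1}}[m],\vec{\mathrm{Q2}}[m],\vec{\mathrm{Q3}}[m],\vec{A}_t[m]\rangle$. $\pi_t[m]$ is the natural map of quotients, induced by the identity of $\mathbb{Z}[\vec{\mathscr{A}}[m]]$. $d_t[m\to n]$ is the (well-defined) homomorphism induced by relabelling by $n+1$ every arrow of a diagram having label $>n+1$. *)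

(* Defs.v *)
From HB Require Import structures.
From mathcomp Require Import all_boot all_order all_algebra.
From mathcomp Require Import generic_quotient ring_quotient finmap.
From mathcomp Require Import boolp classical_sets reals topology normedtype.
From mathcomp Require Import freeg.

Set Implicit Arguments.
Unset Strict Implicit.
Unset Printing Implicit Defensive.

Import Order.TTheory GRing.Theory Num.Theory.
Import numFieldNormedType.Exports.

Local Open Scope fset_scope.
Local Open Scope quotient_scope.
Local Open Scope ring_scope.

(* The extended naturals N u {oo}, with [None] as oo. *)
Definition natoo := option nat.
HB.instance Definition _ := Choice.on natoo.

Definition leoo (x y : natoo) : bool :=
  match x, y with
  | _, None => true
  | None, Some _ => false
  | Some i, Some j => (i <= j)%N
  end.

Definition ltoo (x y : natoo) : bool := ~~ leoo y x.

Definition succoo (x : natoo) : natoo := omap S x.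

(* For m = oo these are the labels 1, 2, ... and oo. *)
Definition is_label (m i : natoo) : bool :=
  leoo (Some 1%N) i && leoo i (succoo m).

Definition label (m : natoo) := {i : natoo | is_label m i}.
HB.instance Definition _ m := SubChoice.on (label m).

Definition truncoo (n i : natoo) : natoo :=
  if ltoo (succoo n) i then succoo n else i.

Lemma truncoo_is_label m n (i : label m) : is_label n (truncoo n (val i)).
Proof.
case: i => -[i|] /andP[/= i1 _]; case: n => [n|]; rewrite /truncoo /ltoo /=.
- by case: (leqP i n.+1) => i_n; rewrite /is_label /= ?i1 ?leqnn.
- by rewrite /is_label /= i1.
- by rewrite /is_label /= leqnn.
- by [].
Qed.

Definition relabel_label m n (i : label m) : label n :=
  Sub (truncoo n (val i)) (truncoo_is_label n i).

Inductive base := Line | Circle.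

Lemma uniq_map_inj (T T' : eqType) (f : T -> T') (s : seq T) :
  uniq (map f s) -> {in s &, injective f}.
Proof.
elim: s => [|x s IH] //= /andP[xs us] a b; rewrite !inE.
have fs y : y \in s -> f y != f x.
  by move=> ys; apply: contraNneq xs => <-; exact: map_f.
move=> /predU1P[->|a_s] /predU1P[->|b_s] // E; last exact: IH.
- by move: (fs _ b_s); rewrite E eqxx.
- by move: (fs _ a_s); rewrite E eqxx.
Qed.

Lemma fsetU3 (K : choiceType) (A : {fset K}) (x y z : K) :
  let S := A `|` [fset x; y; z] in [/\ x \in S, y \in S & z \in S].
Proof. by split; rewrite !inE eqxx ?orbT. Qed.

Lemma imfset3 (K L : choiceType) (f : K -> L) (x y z : K) :
  f @` [fset x; y; z] = [fset f x; f y; f z].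
Proof. by rewrite !imfsetU !imfset_fset1. Qed.

Section Base.
Variables (R : realType) (B : base).

(* The circle is R/Z, oriented by R, with fundamental domain [0, 1[. *)
Definition on_base (x : R) : bool :=
  if B is Circle then 0 <= x < 1 else true.

Definition point := {x : R | on_base x}.
HB.instance Definition _ := SubChoice.on point.

Definition same_point (x y : R) : Prop :=
  if B is Circle then exists k : int, x = y + k%:~R else x = y.

(* Going in the positive direction from [p] one meets [q] strictly before [r];
   the points are then pairwise distinct. *)
Definition between (p q r : point) : bool :=
  let: (x, y, z) := (val p, val q, val r) in
  (x < y < z) || (if B is Circle then (y < z < x) || (z < x < y) else false).

Definition arc_exists (p q : point) : bool :=
  if B is Circle then p != q else val p < val q.

Definition increasing_homeo (F : R -> R) : Prop :=
  [/\ {homo F : x y / x < y}, continuous F &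
      exists G : R -> R, [/\ cancel F G, cancel G F & continuous G]].

(* An orientation-preserving homeomorphism of R/Z is a map with a lift to an
   increasing homeomorphism of R commuting with the unit translation. *)
Definition oriented_homeo (h : point -> point) : Prop :=
  bijective h /\
  exists F : R -> R,
    [/\ increasing_homeo F,
        B = Circle -> forall x, F (x + 1) = F x + 1 &
        forall p, same_point (val (h p)) (F (val p))].

Lemma oriented_homeo_id : oriented_homeo id.
Proof.
split; first by exists id.
exists id; split => //.
  by split=> //; [move=> x; exact: cvg_id | exists id; split=> // x; exact: cvg_id].
by move=> p; rewrite /same_point; case: B => //; exists 0; rewrite addr0.
Qed.

Lemma lift_shift (F : R -> R) : (forall x, F (x + 1) = F x + 1) ->
  forall (k : int) x, F (x + k%:~R) = F x + k%:~R.
Proof.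
move=> F1; have Fn n x : F (x + n%:R) = F x + n%:R.
  by elim: n x => [|n IH] x; rewrite ?addr0 // -[n.+1]addn1 natrD !addrA F1 IH.
case=> n x; first exact: Fn.
rewrite NegzE mulrNz; set c := _%:~R.
by rewrite -[in RHS](subrK c x) (Fn n.+1) addrK.
Qed.

Lemma oriented_homeo_comp h1 h2 :
  oriented_homeo h1 -> oriented_homeo h2 -> oriented_homeo (h2 \o h1).
Proof.
move=> [b1 [F1 [[u1 c1 [G1 [K1 L1 d1]]] s1 e1]]].
move=> [b2 [F2 [[u2 c2 [G2 [K2 L2 d2]]] s2 e2]]].
split; first exact: bij_comp.
exists (F2 \o F1); split.
- split; first by move=> x y xy; exact/u2/u1.
    by move=> x; apply: continuous_comp; [exact: c1|exact: c2].
  exists (G1 \o G2); split; [exact: can_comp|exact: can_comp|].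
  by move=> x; apply: continuous_comp; [exact: d2|exact: d1].
- by move=> Bc x /=; rewrite s1 // s2.
- move=> p /=; move: (e1 p) (e2 (h1 p)); rewrite /same_point.
  case: B s2 => [_ -> -> //|s2] [k E1] [l E2].
  exists (k + l); rewrite E2 E1 (lift_shift (s2 erefl)).
  by rewrite intrD addrA.
Qed.

Lemma oriented_homeo_inv h g : cancel h g -> cancel g h ->
  oriented_homeo h -> oriented_homeo g.
Proof.
move=> hg gh [_ [F [[u c [G [K L d]]] s e]]].
split; first by exists h.
exists G; split.
- split=> //; last by exists F.
  move=> x y xy; rewrite ltNge; apply/negP => GG.
  move: (xy); rewrite -{1}(L x) -{1}(L y) ltNge.
  by move: GG; rewrite le_eqVlt => /predU1P[->|/u/ltW->]; rewrite ?lexx.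
- by move=> Bc x; apply: (can_inj K); rewrite s // !L.
- move=> p; move: (e (g p)); rewrite gh /same_point.
  case: B s => [_ ->|s [k ->]]; first by rewrite K.
  by exists (- k); rewrite -(lift_shift (s erefl)) K mulrNz addrK.
Qed.

End Base.

Section Diagrams.
Variables (R : realType) (B : base) (m : natoo).
Local Notation point := (point R B).

(* [arr_sign] is [true] for the sign (+) and [false] for the sign (-). *)
Record arrow := Arrow {
  arr_tail : point;
  arr_head : point;
  arr_sign : bool;
  arr_label : label m }.

Definition arrow_tuple a :=
  (arr_tail a, arr_head a, arr_sign a, arr_label a).
Definition tuple_arrow (u : point * point * bool * label m) :=
  let: (p, q, s, i) := u in Arrow p q s i.
Lemma arrow_tupleK : cancel arrow_tuple tuple_arrow. Proof. by case. Qed.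
HB.instance Definition _ := Choice.copy arrow (can_type arrow_tupleK).

Definition ends (A : {fset arrow}) : seq point :=
  [seq arr_tail a | a <- enum_fset A] ++ [seq arr_head a | a <- enum_fset A].

(* A diagram in the actual base, before passing to homeomorphism classes. *)
Record diagram := Diagram {
  arrows : {fset arrow};
  _ : uniq (ends arrows) }.
HB.instance Definition _ := [isSub for arrows].
HB.instance Definition _ := [Choice of diagram by <:].

Lemma ends_uniq (D : diagram) : uniq (ends (arrows D)).
Proof. by case: D. Qed.

Lemma tail_inj (D : diagram) : {in arrows D &, injective arr_tail}.
Proof.
have := ends_uniq D; rewrite /ends cat_uniq => /and3P[uT _ _] a b aD bD.
exact: (uniq_map_inj uT).
Qed.

Lemma sub_ends_uniq (A A' : {fset arrow}) :
  A' `<=` A -> uniq (ends A) -> uniq (ends A').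
Proof.
move=> sA uA; pose s := [seq a <- enum_fset A | a \in A'].
have sf : perm_eq (enum_fset A') s.
  apply: uniq_perm; rewrite ?filter_uniq ?fset_uniq // => a.
  by rewrite mem_filter andb_idr //; apply/fsubsetP.
rewrite (perm_uniq (perm_cat (perm_map arr_tail sf) (perm_map arr_head sf))).
apply: subseq_uniq uA.
by apply: cat_subseq; apply: map_subseq; exact: filter_subseq.
Qed.

Definition del (D : diagram) (a : arrow) : diagram :=
  Diagram (sub_ends_uniq (fsubD1set (arrows D) a) (ends_uniq D)).

Definition move_arrow (h : point -> point) (a : arrow) : arrow :=
  Arrow (h (arr_tail a)) (h (arr_head a)) (arr_sign a) (arr_label a).

Definition homeo_rel (D E : diagram) : bool :=
  `[< exists h, oriented_homeo h /\ arrows E = move_arrow h @` arrows D >].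

Lemma homeo_rel_equiv : equiv_class_of homeo_rel.
Proof.
have tr : transitive homeo_rel.
  move=> E D F /asboolP[h [oh eE]] /asboolP[k [ok eF]]; apply/asboolP.
  exists (k \o h); split; first exact: oriented_homeo_comp.
  by rewrite eF eE -imfset_comp.
have sy D E : homeo_rel D E -> homeo_rel E D.
  move=> /asboolP[h [oh eE]]; apply/asboolP.
  case: (oh) => -[g hg gh] _; exists g; split; first exact: oriented_homeo_inv oh.
  rewrite eE -imfset_comp -[LHS]imfset_id; apply: eq_imfset => // -[p q s i].
  by rewrite /move_arrow /= !hg.
split=> //; last by move=> D E; apply/idP/idP; exact: sy.
move=> D; apply/asboolP; exists id; split; first exact: oriented_homeo_id.
by rewrite -[LHS]imfset_id; apply: eq_imfset => // -[].
Qed.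

Canonical homeo_rel_equiv_rel := EquivRelPack homeo_rel_equiv.
Canonical homeo_rel_encModRel := defaultEncModRel homeo_rel.

Definition diag_class := {eq_quot homeo_rel}.
HB.instance Definition _ := Choice.on diag_class.
HB.instance Definition _ := EqQuotient.on diag_class.

Definition ZA := {freeg diag_class}.
HB.instance Definition _ := GRing.Lmodule.on ZA.

Definition gen (D : diagram) : ZA := << \pi_diag_class D >>.

Definition follows (D : diagram) (p q : point) : Prop :=
  arc_exists p q /\ forall r, r \in ends (arrows D) -> ~~ between p r q.

Definition consecutive (D : diagram) (p q : point) : Prop :=
  follows D p q \/ follows D q p.

Definition Q1 : set ZA := [set x : ZA | exists (D : diagram) (a : arrow),
  [/\ a \in arrows D, consecutive D (arr_tail a) (arr_head a),
      val (arr_label a) = succoo m & x = gen D]]%classic.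

Definition Q2 : set ZA := [set x : ZA | exists (D : diagram) (a b : arrow),
  [/\ a \in arrows D /\ b \in arrows D,
      arr_sign a != arr_sign b /\ arr_label a = arr_label b,
      consecutive D (arr_tail a) (arr_tail b),
      consecutive D (arr_head a) (arr_head b) &
      x = gen D + gen (del D a) + gen (del D b)]]%classic.

(* The pair [I] stands for the open arc from [I.1] to [I.2]; since diagrams have
   finitely many endpoints, every interval carrying two of them can be shrunk
   to such an arc. *)
Definition in_arc (I : point * point) (p : point) : bool := between I.1 p I.2.

Definition disjoint_arcs (I J : point * point) : Prop :=
  forall p, ~~ (in_arc I p && in_arc J p).

(* The endpoints of [D] on the arc [I] are [p] and [q], in this order. *)
Definition arc_ends (D : diagram) (I : point * point) (p q : point) : Prop :=
  [/\ in_arc I p, in_arc I q, between I.1 p q &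
      forall r, r \in ends (arrows D) -> in_arc I r -> r = p \/ r = q].

Definition Q3_labels (i j k : natoo) : bool :=
  [|| ltoo j i && (j == k), ltoo i j && (i == k), ltoo i k && (i == j)
    | [&& i == j, j == k & k == succoo m]].

Definition Q3_arrows (D : diagram) (a b c : arrow) : Prop :=
  [/\ a \in arrows D, b \in arrows D & c \in arrows D] /\
  [/\ arr_sign a = arr_sign b, arr_sign b = arr_sign c &
      Q3_labels (val (arr_label a)) (val (arr_label b)) (val (arr_label c))] /\
  exists I1 I2 I3 : point * point,
    [/\ disjoint_arcs I1 I2, disjoint_arcs I1 I3 & disjoint_arcs I2 I3] /\
    [/\ arc_ends D I1 (arr_tail a) (arr_tail b),
        arc_ends D I2 (arr_head a) (arr_tail c) &
        arc_ends D I3 (arr_head b) (arr_head c)].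

(* Reversing the order on the three intervals exchanges the positions of the
   tails of [a] and [b], of the head of [a] and the tail of [c], and of the heads
   of [b] and [c]. *)
Definition Q3 : set ZA := [set x : ZA | exists (D D' : diagram) (a b c : arrow),
  let a' := Arrow (arr_tail b) (arr_tail c) (arr_sign a) (arr_label a) in
  let b' := Arrow (arr_tail a) (arr_head c) (arr_sign b) (arr_label b) in
  let c' := Arrow (arr_head a) (arr_head b) (arr_sign c) (arr_label c) in
  [/\ Q3_arrows D a b c,
      arrows D' = (arrows D `\` [fset a; b; c] `|` [fset a'; b'; c'])%fset &
      x = (gen D + gen (del D a) + gen (del D b) + gen (del D c))
        - (gen D' + gen (del D' a') + gen (del D' b') + gen (del D' c'))]]%classic.

Definition many_arrows (t : nat) : set ZA := [set x : ZA | exists D : diagram,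
  (t < #|` arrows D|)%N /\ x = gen D]%classic.

Definition relators (t : nat) : set ZA :=
  (Q1 `|` Q2 `|` Q3 `|` many_arrows t)%classic.

End Diagrams.

Section Generated.
Variables (G : zmodType) (S : set G).

Definition generated : pred G := fun x => `[<
  forall H : {pred G}, zmod_closed H -> (forall y, S y -> y \in H) -> x \in H >].

Lemma generated_closed : zmod_closed generated.
Proof.
split=> [|x y /asboolP gx /asboolP gy]; apply/asboolP => H cH SH.
  by case: cH.
by case: (cH) => _ HB; apply: HB; [exact: gx|exact: gy].
Qed.
HB.instance Definition _ := GRing.isZmodClosed.Build G generated generated_closed.

Lemma mem_generated x : S x -> x \in generated.
Proof. by move=> Sx; apply/asboolP => H _; exact. Qed.

End Generated.

Lemma generated_image (G H : zmodType) (f : {additive G -> H})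
    (S : set G) (S' : set H) :
  (forall x, S x -> S' (f x)) ->
  forall x, x \in generated S -> f x \in generated S'.
Proof.
move=> fS x /asboolP gx; pose P : {pred G} := fun y => f y \in generated S'.
have PE y : (y \in P) = (f y \in generated S') by [].
rewrite -PE; apply: gx => [|y /fS Sfy]; last by rewrite PE; exact: mem_generated.
split=> [|u v]; first by rewrite PE raddf0 rpred0.
by rewrite !PE raddfB => fu fv; rewrite rpredB.
Qed.

Section Induced.
Variables (G H : zmodType) (I : zmodClosed G) (J : zmodClosed H).
Variable f : {additive G -> H}.

(* The hypothesis makes the choice of representative irrelevant. *)
Definition induced of (forall x, x \in I -> f x \in J) :
    {ideal_quot I} -> {ideal_quot J} :=
  fun x => \pi_{ideal_quot J} (f (repr x)).

Hypothesis fIJ : forall x, x \in I -> f x \in J.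

Lemma induced_pi x : induced fIJ (\pi_{ideal_quot I} x) = \pi_{ideal_quot J} (f x).
Proof.
apply/eqP; rewrite /induced -Quotient.idealrBE -raddfB; apply: fIJ.
by rewrite Quotient.idealrBE reprK.
Qed.

Lemma induced_additive : zmod_morphism (induced fIJ).
Proof.
move=> x y; rewrite -[x]reprK -[y]reprK -raddfB !induced_pi.
by rewrite raddfB raddfB.
Qed.
HB.instance Definition _ :=
  GRing.isZmodMorphism.Build {ideal_quot I} {ideal_quot J} (induced fIJ) induced_additive.

End Induced.

Lemma leoo_trans : transitive leoo.
Proof. by move=> [j|] [i|] [k|] //=; exact: leq_trans. Qed.

Lemma leoo_total : total leoo.
Proof. by move=> [j|] [i|] //=; exact: leq_total. Qed.

Lemma leoo_anti : antisymmetric leoo.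
Proof. by move=> [j|] [i|] //=; rewrite -eqn_leq => /eqP ->. Qed.

Lemma leoo_succ x y : leoo (succoo x) (succoo y) = leoo x y.
Proof. by case: x; case: y. Qed.

Lemma truncoo_top m n : leoo n m -> truncoo n (succoo m) = succoo n.
Proof.
move=> nm; rewrite /truncoo /ltoo leoo_succ; case: ifPn => //; rewrite negbK => mn.
by congr succoo; apply: leoo_anti; rewrite nm mn.
Qed.

Lemma truncoo_lt n i j : ltoo i j ->
  ltoo (truncoo n i) (truncoo n j) \/
  truncoo n i = succoo n /\ truncoo n j = succoo n.
Proof.
rewrite /truncoo; have [ni|ni] := boolP (ltoo (succoo n) i);
  have [nj|nj] := boolP (ltoo (succoo n) j) => ij; [by right| | |by left].
- exfalso; move: ni nj ij; rewrite /ltoo negbK => /negP ni nj /negP ij.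
  have := leoo_total i (succoo n); rewrite (negbTE (introN idP ni)) /= => ni'.
  by apply: ij; exact: leoo_trans ni'.
- have [E|NE] := eqVneq i (succoo n); [right|left] => //.
  apply/negP => sni; case/negP: NE; apply/eqP/leoo_anti.
  by move: ni; rewrite /ltoo negbK => ->.
Qed.

Lemma truncoo_Q3 m n i j k : leoo n m ->
  Q3_labels m i j k -> Q3_labels n (truncoo n i) (truncoo n j) (truncoo n k).
Proof.
move=> nm; rewrite /Q3_labels => /or4P[] /andP[].
- move=> /[swap] /eqP -> /(truncoo_lt n).
  by case=> [->|[-> ->]]; rewrite !eqxx ?orbT.
- move=> /[swap] /eqP -> /(truncoo_lt n).
  by case=> [->|[-> ->]]; rewrite !eqxx ?orbT.
- move=> /[swap] /eqP -> /(truncoo_lt n).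
  by case=> [->|[-> ->]]; rewrite !eqxx ?orbT.
- by move=> /eqP -> /andP[/eqP -> /eqP ->]; rewrite truncoo_top // !eqxx !orbT.
Qed.

Section Relabelling.
Variables (R : realType) (B : base) (m n : natoo).
Local Notation arrow := (arrow R B).
Local Notation diagram := (diagram R B).

Definition relabel_arrow (a : arrow m) : arrow n :=
  Arrow (arr_tail a) (arr_head a) (arr_sign a) (relabel_label n (arr_label a)).

Lemma relabel_inj (D : diagram m) : {in arrows D &, injective relabel_arrow}.
Proof. by move=> a b aD bD /(congr1 (@arr_tail _ _ _)) /(tail_inj aD bD). Qed.

Lemma relabel_ends (D : diagram m) :
  perm_eq (ends (relabel_arrow @` arrows D)) (ends (arrows D)).
Proof.
have pe : perm_eq (enum_fset (relabel_arrow @` arrows D))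
                  [seq relabel_arrow a | a <- enum_fset (arrows D)].
  apply: uniq_perm; first exact: fset_uniq.
    by rewrite map_inj_in_uniq ?fset_uniq //; exact: relabel_inj.
  by move=> x; apply/imfsetP/mapP => -[a aD ->]; exists a.
rewrite /ends (permPl (perm_cat (perm_map (@arr_tail R B n) pe)
                                (perm_map (@arr_head R B n) pe))).
by rewrite -!map_comp.
Qed.

Lemma relabel_uniq (D : diagram m) : uniq (ends (relabel_arrow @` arrows D)).
Proof. by rewrite (perm_uniq (relabel_ends D)) ends_uniq. Qed.

Definition relabel (D : diagram m) : diagram n := Diagram (relabel_uniq D).

Definition relabel_class (x : diag_class R B m) : diag_class R B n :=
  \pi_(diag_class R B n) (relabel (repr x)).

Lemma relabel_class_pi (D : diagram m) :
  relabel_class (\pi_(diag_class R B m) D) = \pi_(diag_class R B n) (relabel D).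
Proof.
apply/eqP; rewrite eqmodE; apply/asboolP.
have : homeo_rel (repr (\pi_(diag_class R B m) D)) D.
  by rewrite -eqmodE reprK.
move=> /asboolP[h [oh E]]; exists h; split=> //=.
by rewrite E -!imfset_comp.
Qed.

Definition relabelZ : ZA R B m -> ZA R B n :=
  fglift (fun x => << relabel_class x >> : ZA R B n).

HB.instance Definition _ :=
  GRing.isZmodMorphism.Build (ZA R B m) (ZA R B n) relabelZ
    (lift_is_additive _).

Lemma relabelZ_gen (D : diagram m) : relabelZ (gen D) = gen (relabel D).
Proof. by rewrite /relabelZ /gen liftU relabel_class_pi scale1r. Qed.

Lemma mem_relabel_ends (D : diagram m) p :
  (p \in ends (arrows (relabel D))) = (p \in ends (arrows D)).
Proof. exact: perm_mem (relabel_ends D) p. Qed.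

Lemma relabel_consecutive (D : diagram m) p q :
  consecutive D p q -> consecutive (relabel D) p q.
Proof.
by case=> -[pq H]; [left|right]; split=> // r; rewrite mem_relabel_ends; exact: H.
Qed.

Lemma relabel_arc_ends (D : diagram m) I p q :
  arc_ends D I p q -> arc_ends (relabel D) I p q.
Proof. by case=> ? ? ? H; split=> // r; rewrite mem_relabel_ends; exact: H. Qed.

Lemma mem_relabel (D : diagram m) a :
  a \in arrows D -> relabel_arrow a \in arrows (relabel D).
Proof. by move=> aD; exact: in_imfset. Qed.

Lemma relabel_fsetD (D : diagram m) (A : {fset arrow m}) :
  A `<=` arrows D ->
  relabel_arrow @` (arrows D `\` A) =
  (relabel_arrow @` arrows D) `\` (relabel_arrow @` A).
Proof.
move=> /fsubsetP sA; apply/fsetP => x; apply/imfsetP/fsetDP.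
  move=> [a /= /fsetDP[aD aA] ->]; split; first exact: mem_relabel.
  apply/negP => /imfsetP[b /= bA /(relabel_inj aD (sA _ bA)) ab].
  by rewrite ab bA in aA.
move=> [/imfsetP[a /= aD ->] NA]; exists a => //=; rewrite inE aD andbT.
by apply: contra NA; exact: in_imfset.
Qed.

Lemma relabel_swap (D D' : diagram m) (S S' : {fset arrow m})
    (T T' : {fset arrow n}) :
  S `<=` arrows D -> relabel_arrow @` S = T -> relabel_arrow @` S' = T' ->
  arrows D' = (arrows D `\` S) `|` S' ->
  arrows (relabel D') = (arrows (relabel D) `\` T) `|` T'.
Proof. by move=> sS <- <- E; rewrite /= E imfsetU relabel_fsetD. Qed.

Lemma relabel_del (D : diagram m) a : a \in arrows D ->
  relabel (del D a) = del (relabel D) (relabel_arrow a).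
Proof.
move=> aD; apply: val_inj; rewrite /= relabel_fsetD ?fsub1set //.
by rewrite imfset_fset1.
Qed.

Lemma relabel_relators t x : leoo n m ->
  relators t x -> relators t (relabelZ x).
Proof.
move=> nm [[[|]|]|].
- move=> [D [a [aD con la ->]]]; left; left; left; rewrite relabelZ_gen.
  exists (relabel D), (relabel_arrow a); split=> //; first exact: mem_relabel.
    exact: relabel_consecutive.
  by rewrite /= la truncoo_top.
- move=> [D [a [b [[aD bD] [sg lb] ct ch ->]]]]; left; left; right.
  exists (relabel D), (relabel_arrow a), (relabel_arrow b); split.
  + by split; exact: mem_relabel.
  + by rewrite /= lb.
  + exact: relabel_consecutive.
  + exact: relabel_consecutive.
  + by rewrite !raddfD /= !relabelZ_gen !relabel_del.
- move=> [D [D' [a [b [c]]]]]; set a' := Arrow _ _ _ _; set b' := Arrow _ _ _ _.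
  set c' := Arrow _ _ _ _.
  move=> [[[aD bD cD] [[sab sbc lab] [I1 [I2 [I3 [dis [e1 e2 e3]]]]]]] ED' ->].
  have [a'D b'D c'D] := fsetU3 (arrows D `\` [fset a; b; c]) a' b' c'.
  rewrite -ED' in a'D b'D c'D.
  left; right; exists (relabel D), (relabel D'), (relabel_arrow a),
    (relabel_arrow b), (relabel_arrow c); split.
  + split; first by split; exact: mem_relabel.
    split; first by split=> //; exact: truncoo_Q3 nm _.
    by exists I1, I2, I3; split=> //; split; exact: relabel_arc_ends.
  + apply: (relabel_swap _ (imfset3 _ a b c) (imfset3 _ a' b' c') ED').
    by rewrite !fsubUset !fsub1set aD bD cD.
  + by rewrite raddfB !raddfD /= !relabelZ_gen !relabel_del.
- move=> [D [lt_t ->]]; right; exists (relabel D); rewrite relabelZ_gen.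
  by split=> //=; rewrite card_in_imfset //; exact: relabel_inj.
Qed.

End Relabelling.

Section Polyak.
Variables (R : realType) (B : base).

Definition relations (m : natoo) (t : nat) : {pred ZA R B m} :=
  generated (relators t).
HB.instance Definition _ m t := GRing.ZmodClosed.on (@relations m t).

Definition X (m : natoo) (t : nat) := {ideal_quot @relations m t}.
HB.instance Definition _ m t := GRing.Zmodule.on (X m t).

Lemma relations_pred m t x :
  x \in @relations m t -> (idfun x : ZA R B m) \in @relations m t.-1.
Proof.
apply: generated_image => {}x [H|[D [lt_t ->]]]; [by left|right].
by exists D; split=> //; exact: leq_ltn_trans (leq_pred t) lt_t.
Qed.

Lemma relations_relabel m n t (nm : leoo n m) x :
  x \in @relations m t -> relabelZ n x \in @relations n t.
Proof. by apply: generated_image => {}x; exact: relabel_relators. Qed.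

Definition proj m t : {additive X m t -> X m t.-1} :=
  induced (@relations_pred m t).

Definition d_map m n t (nm : leoo n m) : {additive X m t -> X n t} :=
  induced (@relations_relabel m n t nm).

Lemma proj_pi m t (x : ZA R B m) :
  proj m t (\pi_(X m t) x) = \pi_(X m t.-1) x.
Proof. exact: induced_pi. Qed.

Lemma d_map_gen m n t (nm : leoo n m) (D : diagram R B m) :
  d_map t nm (\pi_(X m t) (gen D)) = \pi_(X n t) (gen (relabel n D)).
Proof. by rewrite -relabelZ_gen; exact: induced_pi. Qed.

End Polyak.

(* Main.v *)
Require Import Defs.
From mathcomp Require Import all_boot all_order all_algebra reals.
From mathcomp Require Import generic_quotient ring_quotient.

Local Open Scope quotient_scope.

(** A point of the quotient is the class of a combination of diagrams, so this
    form, more general than [d_map_gen], spares an induction on the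
    combination. *)
Lemma d_map_pi (R : realType) (B : base) (m n : natoo) (t : nat)
    (nm : leoo n m) (x : ZA R B m) :
  d_map R B t nm (\pi_(X R B m t) x) = \pi_(X R B n t) (relabelZ n x).
Proof. exact: induced_pi. Qed.

(** The maps [proj] are induced by the identity of the free group on diagrams,
    and the maps [d_map] by [relabelZ n], which does not depend on the bound on
    the number of arrows. So both composites send the class of [x] to the class
    of [relabelZ n x], and every element of the quotient is such a class. *)
Theorem theorem5 (R : realType) (B : base) (t : nat) (m n : natoo)
    (ht : (2 <= t)%N) (hn : leoo (Some 1%N) n) (hnm : leoo n m) :
  (d_map R B t.-1 hnm \o proj R B m t : X R B m t -> X R B n t.-1) =1
  (proj R B n t \o d_map R B t hnm : X R B m t -> X R B n t.-1).
Proof.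
move=> u; rewrite /comp -[u]reprK.
by rewrite proj_pi !d_map_pi proj_pi.
Qed.
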